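(* (Representation Theorem) For each bounded implicative meet semi-lattice $L$, $L$ is isomorphic to $(L_* )^*$; that is, there exists a generalized Esakia space $X$ such that $L$ is isomorphic, as a bounded implicative meet semi-lattice, to $\langle X^*,\cap,\to,X,\emptyset\rangle$, where $U\to V=X-{\downarrow}(U-V)$.
   Context: A meet semi-lattice with top is implicative if for each $a$ the map $a\wedge(-)$ has a right adjoint $a\to(-)$ ($a\wedge c\le b$ iff $c\le a\to b$); bounded means it also has a bottom. A filter is a nonempty upset closed under $\wedge$; a prime filter is a filter $F\ne L$ such that $F_1\cap F_2\subseteq F$ for filters $F_1,F_2$ implies $F_1\subseteq F$ or $F_2\subseteq F$; $L_+$ is the set of prime filters; $\sigma(a)=\{y\in L_+:a\in y\}$; $D(L)$ is the lattice of finite unions of sets $\sigma(a)$; a filter $G$ is optimal if $G=\sigma^{-1}(P)$ for a prime filter $P$ of $D(L)$; $L_*$ is the set of optimal filters; $\phi(a)=\{y\in L_*:a\in y\}$; $\tau$ on $L_*$ is generated by the subbasis $\{\phi(a)\}\cup\{L_*-\phi(b)\}$; and $L_*$ also denotes $\langle L_*,\tau,\subseteq,L_+\rangle$. A Priestley space is a compact space with a partial order $\le$ such that if $x\not\le y$ there is a clopen upset containing $x$ and not $y$. For $X=\langle X,\tau,\le,X_0\rangle$ with $\langle X,\tau,\le\rangle$ Priestley and $X_0\subseteq X$, $X^*$ is the set of clopen upsets $U$ with $\mathrm{max}(X-U)\subseteq X_0$, and $\mathcal{I}_x=\{U\in X^*:x\notin U\}$. $X$ is a generalized Priestley space if: $X_0$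 is dense; every $x$ lies below some $y\in X_0$; $x\in X_0$ iff for all $U,V\in\mathcal{I}_x$ there is $W\in\mathcal{I}_x$ with $U\cup V\subseteq W$; and $x\le y$ iff every $U\in X^*$ containing $x$ contains $y$. It is a generalized Esakia space if moreover ${\downarrow}U$ is clopen whenever $U=\bigcup_{i=1}^n(U_i-V_i)$ with $U_i,V_i\in X^*$. *)

(* Defs.v *)
From HB Require Import structures.
From mathcomp Require Import all_boot all_order.
From mathcomp Require Import boolp classical_sets functions topology.

Set Implicit Arguments.
Unset Strict Implicit.
Unset Printing Implicit Defensive.

Import Order.TTheory.
Import SetOrder.Exports.

Local Open Scope classical_set_scope.

Definition implication d (L : meetSemilatticeType d) (imp : L -> L -> L) :=
  forall a b c : L, (Order.meet a c <= b)%O <-> (c <= imp a b)%O.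

Section Filters.
Context d (L : meetSemilatticeType d).

Record msl_filter (F : set L) : Prop := MslFilter {
  msl_filter_neq0 : F !=set0;
  msl_filter_up : forall a b, (a <= b)%O -> F a -> F b;
  msl_filter_meet : forall a b, F a -> F b -> F (Order.meet a b) }.

Record prime_filter (F : set L) : Prop := PrimeFilter {
  prime_filter_filter : msl_filter F;
  prime_filter_neqT : F <> [set: L];
  prime_filter_prime : forall F1 F2, msl_filter F1 -> msl_filter F2 ->
    F1 `&` F2 `<=` F -> F1 `<=` F \/ F2 `<=` F }.

Definition sigma (a : L) : set (set L) := [set y | prime_filter y /\ y a].

Definition finite_unions_sigma : set (set (set L)) :=
  [set U | exists s : seq L, U = \bigcup_(a in [set` s]) sigma a].

Lemma sigmaI a b : sigma a `&` sigma b = sigma (Order.meet a b).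
Proof.
apply/seteqP; split=> y /=.
  move=> [[py ya] [_ yb]]; split=> //.
  by apply: (msl_filter_meet (prime_filter_filter py)).
move=> [py yab]; have up := msl_filter_up (prime_filter_filter py).
by split; split=> //; apply: up yab; [exact: leIl | exact: leIr].
Qed.

Lemma sigma_finite_unions a : finite_unions_sigma (sigma a).
Proof.
exists [:: a]; apply/seteqP; split=> y.
  by move=> ya; exists a => //=; rewrite inE.
by move=> [b /=]; rewrite inE => /eqP ->.
Qed.

Lemma finite_unions_sigmaI : meet_closed (mem finite_unions_sigma).
Proof.
move=> U V; rewrite !inE => -[s ->] [t ->].
exists [seq Order.meet a b | a <- s, b <- t]; apply/seteqP; split=> y.
  move=> [[a /= sa ya] [b /= tb yb]]; exists (Order.meet a b).
    by apply/allpairsP; exists (a, b).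
  by rewrite -sigmaI.
move=> [_ /= /allpairsP[[a b] /= [sa tb ->]]]; rewrite -sigmaI => -[ya yb].
by split; [exists a | exists b].
Qed.

Lemma finite_unions_sigmaU : join_closed (mem finite_unions_sigma).
Proof.
move=> U V; rewrite !inE => -[s ->] [t ->].
exists (s ++ t); apply/seteqP; split=> y.
  by move=> [[a /= sa ya]|[a /= ta ya]]; exists a => //=;
    rewrite mem_cat ?sa ?ta ?orbT.
move=> [a /=]; rewrite mem_cat => /orP[sa|ta] ya; first by left; exists a.
by right; exists a.
Qed.

HB.instance Definition _ :=
  Order.isLatticeClosed.Build _ _ (mem finite_unions_sigma)
    finite_unions_sigmaI finite_unions_sigmaU.

(* D(L), with the order and lattice operations inherited from the power set *)
Record DL := MkDL {
  DL_val : set (set L);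
  DL_mem : DL_val \in mem finite_unions_sigma }.

HB.instance Definition _ := [isSub for DL_val].
HB.instance Definition _ := [Choice of DL by <:].
HB.instance Definition _ :=
  [SubChoice_isSubLattice of DL by <: with set_display].

Lemma DL_leE (U V : DL) : (U <= V)%O <-> DL_val U `<=` DL_val V.
Proof. by rewrite -Order.le_val subsetEset. Qed.

Lemma DL_meetE (U V : DL) : DL_val (Order.meet U V) = DL_val U `&` DL_val V.
Proof. by []. Qed.

Lemma DL_joinE (U V : DL) : DL_val (Order.join U V) = DL_val U `|` DL_val V.
Proof. by []. Qed.

Definition sigmaD (a : L) : DL :=
  MkDL (mem_set (sigma_finite_unions a)).

End Filters.

Section Optimal.
Context d (L : meetSemilatticeType d).

Definition optimal : set (set L) :=
  [set G | exists2 P : set (DL L), prime_filter P & G = @sigmaD d L @^-1` P].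

(* L_+ is included in L_* *)
Lemma prime_filter_optimal (F : set L) : prime_filter F -> optimal F.
Proof.
move=> pF; exists [set U : DL L | DL_val U F].
  have upP (U V : DL L) : (U <= V)%O -> DL_val U F -> DL_val V F.
    by move=> /DL_leE; apply.
  split; first split.
  - case: (msl_filter_neq0 (prime_filter_filter pF)) => a Fa.
    by exists (sigmaD a).
  - exact: upP.
  - by move=> U V.
  - move=> PT; have [a nFa] : exists a, ~ F a.
      apply: contrapT => /forallNP nF; apply: (prime_filter_neqT pF).
      by apply/seteqP; split=> // a _; exact: contrapT (nF a).
    by have [] : [set U : DL L | DL_val U F] (sigmaD a) by rewrite PT.
  - move=> F1 F2 fF1 fF2 sP; apply: contrapT => /not_orP[].
    move=> /existsNP[U /not_implyP[F1U nUF]] /existsNP[V /not_implyP[F2V nVF]].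
    have /sP : (F1 `&` F2) (Order.join U V).
      split; [apply: (msl_filter_up fF1) F1U; exact: leUl|].
      by apply: (msl_filter_up fF2) F2V; exact: leUr.
    by case.
by apply/seteqP; split=> a //= -[].
Qed.

Record Lstar := MkLstar {
  Lstar_val : set L;
  Lstar_optimal : Lstar_val \in optimal }.

HB.instance Definition _ := [isSub for Lstar_val].
HB.instance Definition _ := [Choice of Lstar by <:].

Definition phi (a : L) : set Lstar := [set y | Lstar_val y a].

Definition phi_subbase : set (set Lstar) :=
  range phi `|` range (fun b => ~` phi b).

HB.instance Definition _ := isSubBaseTopological.Build Lstar phi_subbase id.

End Optimal.

(* Quadruples <X, tau, <=, X_0> *)
Record ordered_space := OrderedSpace {
  carrier :> topologicalType;
  space_le : carrier -> carrier -> Prop;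
  space_pts : set carrier }.

Section Spaces.
Variable X : ordered_space.
Implicit Types (x y : X) (A U V W : set X).

Definition space_po : Prop :=
  [/\ forall x, space_le x x,
      forall x y, space_le x y -> space_le y x -> x = y &
      forall x y z : X, space_le x y -> space_le y z -> space_le x z].

Definition upset U := forall x y, space_le x y -> U x -> U y.

Definition down A : set X := [set x | exists2 y, A y & space_le x y].

Definition maxpts A : set X :=
  [set x | A x /\ forall y, A y -> space_le x y -> y = x].

Definition priestley : Prop :=
  [/\ compact [set: X], space_po &
      forall x y, ~ space_le x y ->
        exists U, [/\ clopen U, upset U, U x & ~ U y]].

(* X^* *)
Definition star : set (set X) :=
  [set U | [/\ clopen U, upset U & maxpts (~` U) `<=` @space_pts X]].

(* I_x *)
Definition star_avoid x : set (set X) := [set U | star U /\ ~ U x].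

Record generalized_priestley : Prop := GeneralizedPriestley {
  gp_priestley : priestley;
  gp_dense : dense (@space_pts X);
  gp_below : forall x, exists2 y, space_pts y & space_le x y;
  gp_pts : forall x, space_pts x <->
    (forall U V, star_avoid x U -> star_avoid x V ->
       exists2 W, star_avoid x W & U `|` V `<=` W);
  gp_le : forall x y, space_le x y <-> (forall U, star U -> U x -> U y) }.

Record generalized_esakia : Prop := GeneralizedEsakia {
  ge_priestley : generalized_priestley;
  ge_down : forall n (U V : 'I_n -> set X),
    (forall i, star (U i)) -> (forall i, star (V i)) ->
    clopen (down (\bigcup_i (U i `\` V i))) }.

Definition star_imp U V : set X := ~` down (U `\` V).

(* f is an isomorphism of bounded implicative meet semi-lattices from L onto
   <X^*, cap, ->, X, empty>; closure of X^* under these operations is a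
   consequence, f being onto X^*. *)
Record star_iso d (L : tbMeetSemilatticeType d) (imp : L -> L -> L)
    (f : L -> set X) : Prop := StarIso {
  star_iso_bij : set_bij [set: L] star f;
  star_iso_meet : forall a b, f (Order.meet a b) = f a `&` f b;
  star_iso_imp : forall a b, f (imp a b) = star_imp (f a) (f b);
  star_iso_top : f \top%O = [set: X];
  star_iso_bottom : f \bot%O = set0 }.

Definition star_isomorphic d (L : tbMeetSemilatticeType d)
    (imp : L -> L -> L) : Prop :=
  exists f : L -> set X, star_iso imp f.

End Spaces.

(* <L_*, tau, inclusion, L_+> *)
Definition Lstar_space d (L : meetSemilatticeType d) : ordered_space :=
  @OrderedSpace (Lstar L) (fun x y => Lstar_val x `<=` Lstar_val y)
    [set x | prime_filter (Lstar_val x)].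

(* Main.v *)
(* An optimal filter is a nonempty meet-closed set [G] such that whenever
   [sigma a] is covered by [sigma b_1, ..., sigma b_n] and [a] is in [G], some
   [b_i] is in [G].  If [F] is an ultrafilter on [L_*], the [a] with [phi a] in
   [F] form such a set, and [F] converges to it: hence [L_*] is compact.

   A filter is prime exactly when its complement is nonempty and up-directed.
   A filter maximal among those avoiding [c] is therefore prime as soon as [L]
   is distributive, in particular when [L] is implicative.  So prime filters
   separate filters from points; hence [phi] is an order embedding and
   [down (phi a - phi b)] is the complement of [phi (a -> b)].

   Finally let [U] be in [X^*] and [x] outside [U].  Compactness puts [x] below
   a maximal point [z] outside [U], which is a prime filter.  The sets [phi a]
   with [a] not in [z] cover [U] and are directed, so a single one of them
   contains [U].  Thus [U] is the intersection of the sets [phi c] containing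
   it; these [c] form a filter, so by compactness [U] is itself some [phi c]. *)
Require Import Defs.
From HB Require Import structures.
From mathcomp Require Import all_boot all_order.
From mathcomp Require Import boolp classical_sets functions topology.
From mathcomp Require Import cardinality finmap.

Set Implicit Arguments.
Unset Strict Implicit.
Unset Printing Implicit Defensive.

Import Order.TTheory.

Local Open Scope classical_set_scope.

Lemma Zorn_above (T : Type) (R : T -> T -> Prop) (A : set T) (x : T) :
  (forall t, R t t) -> (forall r s t, R r s -> R s t -> R r t) ->
  (forall s t, R s t -> R t s -> s = t) ->
  (forall C, C !=set0 -> C `<=` A -> total_on C R ->
     exists2 u, A u & forall c, C c -> R c u) ->
  A x -> exists m, [/\ A m, R x m & forall y, A y -> R m y -> y = m].
Proof.
move=> Rxx Rtrans Ranti chain_ub Ax.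
pose S := {y | A y /\ R x y}.
have [| | |C Ctot|[m [Am xm]] mmax] :=
    @Zorn S (fun s t => `[< R (sval s) (sval t) >]).
- by move=> s; apply/asboolP.
- by move=> r s t /asboolP rs /asboolP st; apply/asboolP; exact: Rtrans st.
- by move=> [s ?] [t ?] /asboolP st /asboolP ts; exact/eq_exist/Ranti.
- have [->|/set0P[c0 Cc0]] := eqVneq C set0.
    by exists (exist _ x (conj Ax (Rxx x))).
  have [|_ [c _ <-]|_ _ [b Cb <-] [c Cc <-]|u Au Cu] := chain_ub (sval @` C).
  + by exists (sval c0), c0.
  + by have [] := svalP c.
  + by have [/asboolP|/asboolP] := Ctot _ _ Cb Cc; [left|right].
  have xu : R x u.
    by have [_ xc0] := svalP c0; apply: Rtrans xc0 (Cu _ _); exists c0.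
  by exists (exist _ u (conj Au xu)) => c Cc; apply/asboolP/Cu; exists c.
exists m; split=> // y Ay my; have xy := Rtrans _ _ _ xm my.
by have /(congr1 sval) := mmax (exist _ y (conj Ay xy)) (asboolT my).
Qed.

Lemma compact_directed_subset (X : topologicalType) (I : Type) (D : set I)
    (K : I -> set X) (U : set X) :
  compact [set: X] -> open U -> D !=set0 ->
  (forall i j, D i -> D j -> exists2 k, D k & K k `<=` K i `&` K j) ->
  (forall i, D i -> closed (K i)) -> \bigcap_(i in D) K i `<=` U ->
  exists2 i, D i & K i `<=` U.
Proof.
move=> cX oU D0 Kdir Kcl KU; apply: contrapT => /forall2NP nKU.
have fK : ProperFilter (filter_from D (fun i => K i `\` U)).
  apply: filter_from_proper => [|i Di].
    apply: filter_from_filter => // i j Di Dj.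
    have [k Dk Kij] := Kdir i j Di Dj.
    by exists k => // x [/Kij[Ki Kj] nUx].
  by have [//|/nonsubset] := nKU i.
have [|x [_ xK]] := cX _ fK; first exact: filterT.
have KDx i : D i -> (K i `\` U) x.
  move=> Di; have : closed (K i `\` U).
    by apply: closedI; [exact: Kcl|exact: open_closedC].
  by apply=> B xB; apply: xK xB; exists i.
have [i0 Di0] := D0; have [_] := KDx _ Di0; apply.
by apply: KU => i /KDx[].
Qed.

Lemma ultra_bigcup_seq (T : Type) (I : choiceType) (F : set_system T)
    (s : seq I) (A : I -> set T) : UltraFilter F ->
  F (\bigcup_(i in [set` s]) A i) -> exists2 i, i \in s & F (A i).
Proof.
move=> UF FA; apply: contrapT => /forall2NP nFA.
have FCA : F (\bigcap_(i in [set` [fset i in s]%fset]) ~` A i).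
  apply: filter_bigI => i; rewrite inE => si.
  by have [/(_ si)|nFi] := nFA i; have [|] := in_ultra_setVsetC (A i) UF.
have [x [[i si Ax]]] := filter_ex (filterI FA FCA).
by move=> /(_ i); apply=> //=; rewrite inE.
Qed.

Section OrderedSpace.
Variable X : ordered_space.
Implicit Types (x y : X) (A : set X).

Lemma down_bigcup I (D : set I) (A : I -> set X) :
  Defs.down (\bigcup_(i in D) A i) = \bigcup_(i in D) Defs.down (A i).
Proof.
apply/seteqP; split=> x.
  by move=> [y [i Di Ay] xy]; exists i => //; exists y.
by move=> [i Di [y Ay xy]]; exists y => //; exists i.
Qed.

Lemma priestley_closed_up x : priestley X -> closed [set y | space_le x y].
Proof.
move=> [_ _ sep].
rewrite (_ : mkset _ = \bigcap_(U in [set U | [/\ clopen U, upset U & U x]]) U).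
  by apply: closed_bigI => U [[]].
apply/seteqP; split=> y /=; first by move=> xy U [_ upU]; exact: upU.
move=> Uy; apply: contrapT => /sep[U [cU upU Ux]].
by apply; exact: Uy.
Qed.

Lemma priestley_maxpts_above A x : priestley X -> closed A -> A x ->
  exists2 m, maxpts A m & space_le x m.
Proof.
move=> pX clA Ax; have [cX [refl_le anti_le trans_le] _] := pX.
suff chain_ub C : C !=set0 -> C `<=` A -> total_on C (@space_le X) ->
    exists2 u, A u & forall c, C c -> space_le c u.
  have [m [Am xm mmax]] := Zorn_above refl_le trans_le anti_le chain_ub Ax.
  by exists m.
move=> C0 CA Ctot; apply: contrapT => /forall2NP noub.
have [b c Cb Cc|c _|y yC|c Cc /(_ c)[]] := @compact_directed_subset X _ C
    (fun c => A `&` [set y | space_le c y]) set0 cX open0 C0.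
- have [bc|cb] := Ctot _ _ Cb Cc; [exists c|exists b] => // y [Ay] /= le_y.
    by split; split=> //; exact: trans_le le_y.
  by split; split=> //; exact: trans_le le_y.
- by apply: closedI => //; exact: priestley_closed_up.
- have [c0 /yC[Ay _]] := C0.
  by have [//|] := noub y; apply=> c /yC[].
- by split; [exact: CA|exact: refl_le].
Qed.

End OrderedSpace.

Section Filters.
Context d (L : meetSemilatticeType d).
Implicit Types (a b c : L) (s : seq L) (F : set L).

Lemma msl_filter_ge a : msl_filter [set b | (a <= b)%O].
Proof.
split; first by exists a => /=.
  by move=> b c bc /= ab; exact: le_trans bc.
by move=> b c /= ab ac; rewrite lexI ab ac.
Qed.

Lemma msl_filter_bigcup_chain (C : set (set L)) : C !=set0 ->
  (forall F, C F -> msl_filter F) -> total_on C subset ->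
  msl_filter (\bigcup_(F in C) F).
Proof.
move=> [F0 CF0] fC Ctot; split.
- by have [[a F0a] _ _] := fC _ CF0; exists a, F0.
- move=> a b ab [F CF Fa]; exists F => //.
  exact: (msl_filter_up (fC _ CF) ab).
- move=> a b [F CF Fa] [G CG Gb].
  have [FG|GF] := Ctot _ _ CF CG; [exists G|exists F] => //.
    by apply: (msl_filter_meet (fC _ CG)) => //; exact: FG.
  by apply: (msl_filter_meet (fC _ CF)) => //; exact: GF.
Qed.

Definition filter_adjoin F a : set L :=
  [set c | exists2 g, F g & (Order.meet g a <= c)%O].

Lemma msl_filter_adjoin F a : msl_filter F -> msl_filter (filter_adjoin F a).
Proof.
case=> [[g Fg] _ Fmeet]; split; first by exists (Order.meet g a), g.
  by move=> b c bc [h Fh hb]; exists h => //; exact: le_trans bc.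
move=> b c [h Fh hb] [k Fk kc]; exists (Order.meet h k); first exact: Fmeet.
by rewrite lexI (le_trans _ hb) ?(le_trans _ kc) // leI2 // ?leIl ?leIr.
Qed.

Lemma sub_filter_adjoin F a : F `<=` filter_adjoin F a.
Proof. by move=> g Fg; exists g => //; exact: leIl. Qed.

Lemma filter_adjoin_self F a : F !=set0 -> filter_adjoin F a a.
Proof. by case=> g Fg; exists g => //; exact: leIr. Qed.

Lemma prime_filterP F : prime_filter F <->
  [/\ msl_filter F, exists a, ~ F a &
      forall a b, ~ F a -> ~ F b ->
        exists c, [/\ ~ F c, (a <= c)%O & (b <= c)%O]].
Proof.
split=> [[fF FT Fprime]|[fF [a nFa] dirF]].
  split=> // [|a b nFa nFb].
    by apply/existsNP => FE; apply: FT; apply/seteqP; split=> // a _; exact: FE.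
  apply: contrapT => /forallNP noub.
  have [c [/= ac bc]|sub|sub] := Fprime _ _ (msl_filter_ge a) (msl_filter_ge b).
  - by apply: contrapT => nFc; apply: (noub c).
  - by apply/nFa/sub => /=.
  - by apply/nFb/sub => /=.
split=> // [FT|F1 F2 fF1 fF2 F12]; first by apply: nFa; rewrite FT.
apply: contrapT => /not_orP[].
move=> /existsNP[b /not_implyP[F1b nFb]] /existsNP[c /not_implyP[F2c nFc]].
have [e [nFe be ce]] := dirF _ _ nFb nFc.
by apply: nFe; apply: F12; split;
  [exact: (msl_filter_up fF1 be)|exact: (msl_filter_up fF2 ce)].
Qed.

Lemma prime_filter_seq_ub F s : prime_filter F ->
  (forall a, a \in s -> ~ F a) ->
  exists2 c, (forall a, a \in s -> (a <= c)%O) & ~ F c.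
Proof.
move=> /prime_filterP[_ [a0 nFa0] dirF].
elim: s => [|a s IH] nFs; first by exists a0.
have [|b sb nFb] := IH; first by move=> b bs; apply: nFs; rewrite inE bs orbT.
have [c [nFc ac bc]] := dirF _ _ (nFs _ (mem_head a s)) nFb.
exists c => // e; rewrite inE => /orP[/eqP->//|/sb eb].
exact: le_trans bc.
Qed.

End Filters.

Section Distributive.
Context d (L : meetSemilatticeType d).

Definition distributive_msl : Prop :=
  forall a b c : L, (Order.meet a b <= c)%O ->
    exists a' b', [/\ (a <= a')%O, (b <= b')%O & c = Order.meet a' b'].

Lemma implication_distributive (imp : L -> L -> L) :
  implication imp -> distributive_msl.
Proof.
move=> himp a b c abc; exists (imp b c), (imp (imp b c) c).
split; first by apply/himp; rewrite meetC.
  by apply/himp; rewrite meetC; apply/himp.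
apply/eqP; rewrite eq_le lexI; apply/andP; split; last exact/himp.
by apply/andP; split; apply/himp; exact: leIr.
Qed.

Lemma prime_filter_separation (F : set L) (c : L) : distributive_msl ->
  msl_filter F -> ~ F c -> exists G, [/\ prime_filter G, F `<=` G & ~ G c].
Proof.
move=> Ldist fF nFc.
have [| | |C C0 CQ Ctot|//|G [[fG nGc] FG Gmax]] :=
    @Zorn_above (set L) subset [set G | msl_filter G /\ ~ G c] F.
- exact: subset_refl.
- by move=> F1 F2 F3; exact: subset_trans.
- by move=> F1 F2 F12 F21; exact/seteqP.
- exists (\bigcup_(G in C) G); last by move=> G CG a Ga; exists G.
  split; first by apply: msl_filter_bigcup_chain => // G /CQ[].
  by move=> [G /CQ[]].
exists G; split=> //; apply/prime_filterP; split=> //; first by exists c.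
have adjoin_c a : ~ G a -> exists2 g, G g & (Order.meet g a <= c)%O.
  move=> nGa; apply: contrapT => nadj; apply: nGa.
  rewrite -(Gmax (filter_adjoin G a)); last exact: sub_filter_adjoin.
    by apply: filter_adjoin_self; case: fG.
  by split=> //; exact: msl_filter_adjoin.
move=> a b /adjoin_c[g Gg ga] /adjoin_c[h Gh hb].
(* The upper bound [b'] of [a] and [b] satisfies [c = g' /\ h' /\ b'] with [g']
   and [h'] in [G], so it lies outside [G] with [c]. *)
have [g' [a' [gg' aa' cE]]] := Ldist _ _ _ ga.
have [|h' [b' [hh' bb' a'E]]] := Ldist h b a'.
  by apply: le_trans hb _; rewrite cE leIr.
exists b'; split=> // [Gb'|]; last first.
  by apply: le_trans aa' _; rewrite a'E leIr.
have Ga' : G a'.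
  rewrite a'E; apply: (msl_filter_meet fG) => //.
  exact: (msl_filter_up fG hh').
apply: nGc; rewrite cE; apply: (msl_filter_meet fG) => //.
exact: (msl_filter_up fG gg').
Qed.

End Distributive.

Section OptimalFilters.
Context d (L : meetSemilatticeType d).
Implicit Types (a b c : L) (s : seq L) (G : set L) (P : set (DL L)).

Definition sigma_cover a s : Prop :=
  sigma a `<=` \bigcup_(b in [set` s]) sigma b.

Lemma sigma_cover1 a b : sigma_cover a [:: b] = (sigma a `<=` sigma b).
Proof. by rewrite /sigma_cover set_cons1 bigcup_set1. Qed.

Definition DL_union s : DL L := MkDL (mem_set (ex_intro _ s erefl)).

Lemma DL_unionP (U : DL L) : exists s, U = DL_union s.
Proof.
have /set_mem[s Us] := DL_mem U.
by exists s; apply: val_inj.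
Qed.

Lemma sub_DL_union a s : a \in s -> (sigmaD a <= DL_union s)%O.
Proof. by move=> sa; apply/DL_leE => y ya; exists a. Qed.

Lemma prime_filter_DL_cover P (U : DL L) s : prime_filter P -> P U ->
  (U <= DL_union s)%O -> exists2 b, b \in s & P (sigmaD b).
Proof.
move=> pP PU Us; have fP := prime_filter_filter pP.
apply: contrapT => /forall2NP nPs.
have [_ /mapP[b bs ->]|W sW nPW] :=
    prime_filter_seq_ub (s := [seq sigmaD b | b <- s]) pP.
  by have [] := nPs b.
apply: nPW; apply: (msl_filter_up fP) PU; apply: le_trans Us _.
by apply/DL_leE => y [b /= bs yb]; have /DL_leE := sW _ (map_f _ bs); apply.
Qed.

Definition sigma_prime G : Prop :=
  [/\ G !=set0, forall a b, G a -> G b -> G (Order.meet a b) &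
      forall a s, G a -> sigma_cover a s -> exists2 b, b \in s & G b].

Lemma prime_filter_DL_generated G : sigma_prime G ->
  prime_filter [set U : DL L | exists2 a, G a & (sigmaD a <= U)%O].
Proof.
move=> [[a0 Ga0] Gmeet Gcover]; apply/prime_filterP; split; first split.
- by exists (sigmaD a0), a0.
- by move=> U V UV [a Ga aU]; exists a => //; exact: le_trans UV.
- move=> U V [a Ga aU] [b Gb bV]; exists (Order.meet a b); first exact: Gmeet.
  rewrite lexI; apply/andP; split; [apply: le_trans aU|apply: le_trans bV];
    by apply/DL_leE; rewrite /= -sigmaI => y [].
- by exists (DL_union [::]) => -[a Ga /DL_leE aU]; have [] := Gcover a [::] Ga.
move=> U V; have [s ->] := DL_unionP U; have [t ->] := DL_unionP V => nGs nGt.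
exists (Order.join (DL_union s) (DL_union t)); rewrite leUl leUr; split=> //.
move=> [a Ga /DL_leE ast]; have [|b] := Gcover a (s ++ t) Ga.
  by move=> y /ast[] [b /= bst yb]; exists b => //=; rewrite mem_cat bst ?orbT.
rewrite mem_cat => /orP[bs|bt] Gb.
  by apply: nGs; exists b => //; exact: sub_DL_union.
by apply: nGt; exists b => //; exact: sub_DL_union.
Qed.

Lemma optimalP G : optimal G <-> sigma_prime G.
Proof.
split=> [[P pP ->]|Gprime].
  have fP := prime_filter_filter pP; split.
  - have [U PU] := msl_filter_neq0 fP; have [s Us] := DL_unionP U.
    have [|b _ Pb] := prime_filter_DL_cover (s := s) pP PU; first by rewrite Us.
    by exists b.
  - move=> a b Pa Pb; apply: (msl_filter_up fP) (msl_filter_meet fP Pa Pb).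
    by apply/DL_leE; rewrite DL_meetE /= sigmaI.
  - move=> a s Pa acov; apply: (prime_filter_DL_cover pP Pa).
    exact/DL_leE.
eexists; first exact: prime_filter_DL_generated Gprime.
have [_ _ Gcover] := Gprime; apply/seteqP; split=> b /=.
  by move=> Gb; exists b.
move=> [a Ga /DL_leE ab]; have [|c] := Gcover a [:: b] Ga.
  by rewrite sigma_cover1.
by rewrite inE => /eqP->.
Qed.

Lemma optimal_filter G : optimal G -> msl_filter G.
Proof.
move=> /optimalP[G0 Gmeet Gcover]; split=> // a b ab Ga.
have [|c] := Gcover a [:: b] Ga; last by rewrite inE => /eqP->.
rewrite sigma_cover1 => y [py ya]; split=> //.
exact: (msl_filter_up (prime_filter_filter py) ab).
Qed.

Lemma Lstar_filter (x : Lstar L) : msl_filter (Lstar_val x).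
Proof. by apply: optimal_filter; exact: set_mem (Lstar_optimal x). Qed.

Definition Lstar_prime G (pG : prime_filter G) : Lstar L :=
  MkLstar (mem_set (prime_filter_optimal pG)).

End OptimalFilters.

Section DualSpace.
Context d (L : meetSemilatticeType d).
Implicit Types (a b c : L) (s t : seq L) (x y : Lstar L) (U : set (Lstar L)).
Local Notation X := (Lstar_space L).

Lemma phi_homo a b : (a <= b)%O -> phi a `<=` phi b.
Proof. by move=> ab x; exact: (msl_filter_up (Lstar_filter x) ab). Qed.

Lemma phiI a b : phi (Order.meet a b) = phi a `&` phi b.
Proof.
apply/seteqP; split=> x; last first.
  by move=> [xa xb]; exact: (msl_filter_meet (Lstar_filter x) xa xb).
by move=> xab; split; apply: phi_homo xab; [exact: leIl|exact: leIr].
Qed.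

Lemma sigma_cover_phi a s :
  sigma_cover a s -> phi a `<=` \bigcup_(b in [set` s]) phi b.
Proof.
move=> acov x xa; have /set_mem/optimalP[_ _] := Lstar_optimal x.
by move=> /(_ _ _ xa acov)[b bs xb]; exists b.
Qed.

Lemma upset_phi a : upset (X := X) (phi a).
Proof. by move=> x y; apply. Qed.

Lemma clopen_phi a : clopen (phi a).
Proof.
have open_subbase V : @phi_subbase _ L V -> open V.
  move=> sV; exists [set V]; last by rewrite bigcup_set1.
  by move=> _ ->; exact: finI_from1.
split; first by apply: open_subbase; left; exists a.
by rewrite -openC; apply: open_subbase; right; exists a.
Qed.

Lemma cvg_phi (F : set_system (Lstar L)) x : Filter F ->
  (forall a, phi a x -> F (phi a)) -> (forall a, ~ phi a x -> F (~` phi a)) ->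
  F --> x.
Proof.
move=> FF Fphi FCphi A; rewrite nbhsE => -[U [[D sD <-] [V DV Vx]] UA].
have [s ssub VE] := sD _ DV.
have : F V; last by apply: filterS => y Vy; apply: UA; exists V.
rewrite -VE; apply: filter_bigI => W sW.
have : W x by move: Vx; rewrite -VE; apply.
by have /set_mem[[a _ <-]|[a _ <-]] := ssub _ sW; [exact: Fphi|exact: FCphi].
Qed.

Definition phi_box (p : L * seq L) : set (Lstar L) :=
  phi p.1 `\` \bigcup_(b in [set` p.2]) phi b.

Lemma phi_boxI a b s t :
  phi_box (Order.meet a b, s ++ t) = phi_box (a, s) `&` phi_box (b, t).
Proof.
rewrite /phi_box /= phiI (_ : [set` s ++ t] = [set` s] `|` [set` t]).
  by rewrite bigcup_setU !setDE setCU setIACA.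
by apply/seteqP; split=> c /=; rewrite mem_cat => /orP.
Qed.

Lemma nbhs_phi_box x U : open U -> U x ->
  exists p, phi_box p x /\ phi_box p `<=` U.
Proof.
move=> oU Ux; have [a xa] := msl_filter_neq0 (Lstar_filter x).
pose F := filter_from [set p | phi_box p x] phi_box.
suff /(_ _ (open_nbhs_nbhs (conj oU Ux)))[p px pU] : F --> x by exists p.
have FF : Filter F.
  apply: filter_from_filter; first by exists (a, [::]); split=> // -[].
  move=> [b s] [c t] bsx ctx; exists (Order.meet b c, s ++ t);
    by rewrite /= phi_boxI.
apply: cvg_phi => b; last first.
  by exists (a, [:: b]); rewrite /phi_box /= set_cons1 bigcup_set1 // => y [].
by exists (b, [::]); [split=> // -[]|move=> y []].
Qed.

Lemma dense_prime_filters : dense (@space_pts X).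
Proof.
move=> U [x Ux] oU; have [[a s] [[xa nxs] boxU]] := nbhs_phi_box oU Ux.
have /nonsubset[y [[py ya] nys]] : ~ sigma_cover a s.
  by move=> /sigma_cover_phi/(_ _ xa).
exists (Lstar_prime py); split=> //.
by apply: boxU; split=> // -[b bs yb]; apply: nys; exists b.
Qed.

End DualSpace.

Section Compactness.
Context d (L : tMeetSemilatticeType d).
Implicit Types (a b c : L) (F : set L) (x y : Lstar L) (U : set (Lstar L)).
Local Notation X := (Lstar_space L).

Lemma phi_top : phi (\top%O : L) = setT.
Proof.
apply/seteqP; split=> // x _; have [a xa] := msl_filter_neq0 (Lstar_filter x).
exact: (msl_filter_up (Lstar_filter x) (lex1 a) xa).
Qed.

Lemma compact_Lstar : compact [set: Lstar L].
Proof.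
rewrite compact_ultra => F UF _.
have limF : optimal [set a | F (phi a)].
  apply/optimalP; split=> [|a b /= Fa Fb|a s /= Fa /sigma_cover_phi acov].
  - by exists \top%O; rewrite /= phi_top; exact: filterT.
  - by rewrite phiI; exact: filterI.
  - exact: ultra_bigcup_seq (filterS acov Fa).
exists (MkLstar (mem_set limF)); split=> //; apply: cvg_phi => // a nFa.
by have [] := in_ultra_setVsetC (phi a) UF.
Qed.

Lemma filter_bigcap_phi_subset F U : msl_filter F -> open U ->
  \bigcap_(a in F) phi a `<=` U -> exists2 c, F c & phi c `<=` U.
Proof.
move=> fF oU; apply: compact_directed_subset => //.
- exact: compact_Lstar.
- exact: msl_filter_neq0.
- move=> a b Fa Fb; exists (Order.meet a b); first exact: msl_filter_meet.
  by rewrite phiI.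
- by move=> a _; have [] := clopen_phi a.
Qed.

Lemma prime_filter_bigcup_phi_subset F U : prime_filter F -> closed U ->
  U `<=` \bigcup_(a in ~` F) phi a -> exists2 c, ~ F c & U `<=` phi c.
Proof.
move=> /prime_filterP[_ compl0 dirF] clU; rewrite -setCS setC_bigcup => UF.
have [|a b nFa nFb|a _||c nFc cU] := @compact_directed_subset (Lstar L) L
    (~` F) (fun a => ~` phi a) (~` U) compact_Lstar _ compl0.
- exact: closed_openC.
- have [c [nFc ac bc]] := dirF _ _ nFa nFb; exists c => //.
  by rewrite -setCU setCS subUset; split; exact: phi_homo.
- by apply: open_closedC; have [] := clopen_phi a.
- exact: UF.
- by exists c => //; rewrite -setCS.
Qed.

Lemma priestley_Lstar : priestley X.
Proof.
split; first exact: compact_Lstar.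
  split=> [x //|x y xy yx|x y z]; last exact: subset_trans.
  by apply: val_inj; apply/seteqP.
move=> x y /nonsubset[a [xa nya]].
by exists (phi a); split=> //; [exact: clopen_phi|exact: upset_phi].
Qed.

Lemma star_phi_separation U x : star (X := X) U -> ~ U x ->
  exists2 c, U `<=` phi c & ~ phi c x.
Proof.
move=> [[oU clU] upU maxU] nUx.
have [z [nUz zmax] xz] :=
  priestley_maxpts_above priestley_Lstar (open_closedC oU) nUx.
have [|y Uy|c nzc Uc] :=
    @prime_filter_bigcup_phi_subset (Lstar_val z) U _ clU.
- exact: maxU (conj nUz zmax).
- have /nonsubset[a [ya nza]] : ~ Lstar_val y `<=` Lstar_val z.
    by move=> /upU/(_ Uy).
  by exists a.
- by exists c => // /xz.
Qed.

End Compactness.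

Section Bottom.
Context d (L : bMeetSemilatticeType d).

Lemma phi_bot : phi (\bot%O : L) = set0.
Proof.
rewrite -subset0 -(bigcup_set0 (@phi _ L)) -set_nil.
apply: sigma_cover_phi => y [py ybot]; case: (prime_filter_neqT py).
apply/seteqP; split=> // a _.
exact: (msl_filter_up (prime_filter_filter py) (le0x a) ybot).
Qed.

Lemma not_Lstar_bot (x : Lstar L) : ~ Lstar_val x \bot%O.
Proof. by move=> xbot; have : phi \bot%O x by []; rewrite phi_bot. Qed.

End Bottom.

Section DistributiveDual.
Context d (L : meetSemilatticeType d) (Ldist : distributive_msl L).
Implicit Types (a b c : L) (F : set L).
Local Notation X := (Lstar_space L).

Lemma Lstar_separation F c : msl_filter F -> ~ F c ->
  exists y : Lstar L,
    [/\ prime_filter (Lstar_val y), F `<=` Lstar_val y & ~ phi c y].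
Proof.
move=> fF /(prime_filter_separation Ldist fF)[G [pG FG nGc]].
by exists (Lstar_prime pG).
Qed.

Lemma phi_subset a b : phi a `<=` phi b <-> (a <= b)%O.
Proof.
split=> [ab|]; last exact: phi_homo.
apply: contrapT => /(Lstar_separation (msl_filter_ge a))[y [_ ay]].
by apply; apply: ab; apply: ay => /=.
Qed.

Lemma phi_inj : injective (@phi d L).
Proof.
move=> a b ab; apply/le_anti/andP.
by split; apply/phi_subset; rewrite ab.
Qed.

Lemma star_phi a : star (X := X) (phi a).
Proof.
split; [exact: clopen_phi|exact: upset_phi|move=> x [nxa xmax]].
have [y [py xy nya]] := Lstar_separation (Lstar_filter x) nxa.
by rewrite /= -(xmax y).
Qed.

End DistributiveDual.

Lemma star_range_phi d (L : tMeetSemilatticeType d) :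
  distributive_msl L -> star (X := Lstar_space L) = range (@phi d L).
Proof.
move=> Ldist; apply/seteqP; split=> [U sU|_ [a _ <-]]; last exact: star_phi.
have [[oU _] _ _] := sU.
have fU : msl_filter [set c | U `<=` phi c].
  split=> [|a b ab Ua|a b Ua Ub] /=; first by exists \top%O; rewrite /= phi_top.
    exact: subset_trans (phi_homo ab).
  by rewrite phiI subsetI.
have [|c Uc cU] := filter_bigcap_phi_subset fU oU.
  by move=> x Ux; apply: contrapT => /(star_phi_separation sU)[c /Ux].
by exists c => //; exact/seteqP.
Qed.

Section GeneralizedPriestley.
Context d (L : tbMeetSemilatticeType d) (Ldist : distributive_msl L).
Local Notation X := (Lstar_space L).

Lemma prime_filter_star_avoidP (x : Lstar L) :
  prime_filter (Lstar_val x) <->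
  (forall U V, star_avoid (X := X) x U -> star_avoid (X := X) x V ->
     exists2 W, star_avoid (X := X) x W & U `|` V `<=` W).
Proof.
rewrite /star_avoid (star_range_phi Ldist).
split=> [/prime_filterP[_ _ dirx]|dirx].
  move=> _ _ [[a _ <-] nxa] [[b _ <-] nxb].
  have [c [nxc ac bc]] := dirx _ _ nxa nxb.
  exists (phi c); first by split=> //; exists c.
  by rewrite subUset; split; exact: phi_homo.
apply/prime_filterP; split=> [||a b nxa nxb]; first exact: Lstar_filter.
  by exists \bot%O; exact: not_Lstar_bot.
have [||_ [[c _ <-] nxc]] := dirx (phi a) (phi b).
- by split=> //; exists a.
- by split=> //; exists b.
rewrite subUset => -[/(phi_subset Ldist) ac /(phi_subset Ldist) bc].
by exists c.
Qed.

Lemma generalized_priestley_Lstar : generalized_priestley X.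
Proof.
split.
- exact: priestley_Lstar.
- exact: dense_prime_filters.
- move=> x; have [y [py xy _]] :=
    Lstar_separation Ldist (Lstar_filter x) (@not_Lstar_bot _ _ x).
  by exists y.
- exact: prime_filter_star_avoidP.
- rewrite (star_range_phi Ldist) => x y; split=> [xy _ [a _ <-]|xy a].
    exact: xy.
  by apply: (xy (phi a)); exists a.
Qed.

End GeneralizedPriestley.

Lemma star_imp_phi d (L : meetSemilatticeType d) (imp : L -> L -> L) a b :
  implication imp ->
  star_imp (X := Lstar_space L) (phi a) (phi b) = phi (imp a b).
Proof.
move=> himp; apply/seteqP; split=> x; have fx := Lstar_filter x; last first.
  move=> xab [y [ya nyb] xy]; apply: nyb; have fy := Lstar_filter y.
  apply: (msl_filter_up fy (a := Order.meet a (imp a b))); first exact/himp.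
  by apply: (msl_filter_meet fy) => //; exact: xy.
apply: contra_notP => nxab; have Ldist := implication_distributive himp.
have [|y [_ xy nyb]] :=
    Lstar_separation Ldist (msl_filter_adjoin a fx) (c := b).
  move=> [g xg gab]; apply: nxab; apply: (msl_filter_up fx _ xg).
  by apply/himp; rewrite meetC.
exists y; last by apply: subset_trans xy; exact: sub_filter_adjoin.
by split=> //; apply: xy; apply: filter_adjoin_self; exact: msl_filter_neq0.
Qed.

Section Representation.
Context d (L : tbMeetSemilatticeType d) (imp : L -> L -> L).
Hypothesis himp : implication imp.
Local Notation X := (Lstar_space L).

Lemma generalized_esakia_Lstar : generalized_esakia X.
Proof.
have Ldist := implication_distributive himp.
split=> [|n U V]; first exact: generalized_priestley_Lstar.
rewrite (star_range_phi Ldist) down_bigcup => phiU phiV.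
have clopen_down i : clopen (Defs.down (U i `\` V i)).
  have [[a _ <-] [b _ <-]] := (phiU i, phiV i).
  have -> : Defs.down (X := X) (phi a `\` phi b) = ~` phi (imp a b).
    by rewrite -(star_imp_phi _ _ himp) setCK.
  have [open_phi closed_phi] := clopen_phi (imp a b).
  by split; [exact: closed_openC|exact: open_closedC].
split; first by apply: bigcup_open => i _; have [] := clopen_down i.
apply: closed_bigcup => [|i _]; first exact: finite_finset.
by have [] := clopen_down i.
Qed.

Lemma star_iso_phi : star_iso (X := X) imp (@phi _ L).
Proof.
have Ldist := implication_distributive himp; split.
- split=> [a _|a b _ _|U]; first exact: star_phi.
    exact: phi_inj.
  by rewrite (star_range_phi Ldist).
- exact: phiI.
- by move=> a b; rewrite (star_imp_phi _ _ himp).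
- exact: phi_top.
- exact: phi_bot.
Qed.

End Representation.

Theorem theorem7p6 (d : Order.disp_t) (L : tbMeetSemilatticeType d)
    (imp : L -> L -> L) (himp : implication imp) :
  [/\ generalized_esakia (Lstar_space L),
      star_isomorphic (Lstar_space L) imp
    & exists X : ordered_space,
        generalized_esakia X /\ star_isomorphic X imp].
Proof.
have esakia := generalized_esakia_Lstar himp.
have iso : star_isomorphic (Lstar_space L) imp.
  by exists (@phi _ L); exact: star_iso_phi.
by split=> //; exists (Lstar_space L).
Qed.
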